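(* For every integer $n\geq 3$, the triangular tower graph ${TT}_{n,n,n}$ is claw-contractible-free and claw-free, and its chromatic symmetric function is not $e$-positive.
   Context: All graphs are finite and simple. For a graph $G$ with vertex set $V=\{v_1,\dots,v_N\}$, the chromatic symmetric function is $X_G=\sum_\kappa x_{\kappa(v_1)}\cdots x_{\kappa(v_N)}$, summed over all proper colourings $\kappa:V\to\{1,2,\dots\}$. The elementary symmetric functions are $e_i=\sum_{j_1<\cdots<j_i}x_{j_1}\cdots x_{j_i}$ and $e_\lambda=e_{\lambda_1}\cdots e_{\lambda_\ell}$; they form a basis of the symmetric functions. A symmetric function is $e$-positive if it is a non-negative linear combination of the $e_\lambda$. The claw is $K_{1,3}$. A graph is claw-free if it has no induced subgraph isomorphic to the claw. A graph $G$ contracts to the claw if there is a subset $S$ of its edges such that contracting the edges of $S$ and replacing multiple edges by single edges yields the claw; $G$ is claw-contractible-free if it does not contract to the claw. For $a,b,c\geq 2$, the triangular tower graph ${TT}_{a,b,c}$ is the graph on vertices $v_1,\dots,v_{a+b+c}$ with edges $v_iv_{i+1}$ for $i\in\{1,\dots,a-1\}\cup\{a+1,\dots,a+b-1\}\cup\{a+b+1,\dots,a+b+c-1\}$, together with $v_1v_{a+1}$, $v_{a+1}v_{a+b+1}$, $v_{a+b+1}v_1$ and $v_av_{a+b}$, $v_{a+b}v_{a+b+c}$, $v_{a+b+c}v_a$. *)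

(* Defs.v *)
From HB Require Import structures.
From mathcomp Require Import all_boot all_order fingroup perm all_algebra.
From mathcomp.multinomials Require Import mpoly.

Set Implicit Arguments.
Unset Strict Implicit.
Unset Printing Implicit Defensive.

Import GRing.Theory Num.Theory.
Local Open Scope ring_scope.

Record sgraph := SGraph {
  vertex :> finType;
  adj : rel vertex;
  adj_sym : ssrbool.symmetric adj;
  adj_irr : irreflexive adj }.

Definition edges (G : sgraph) : {set {set G}} :=
  [set e | [exists x, exists y, adj x y && (e == [set x; y])]].

Definition induced_subgraph (H G : sgraph) : Prop :=
  exists f : H -> G, injective f /\ forall x y, adj (f x) (f y) = adj x y.

Definition isomorphic (H G : sgraph) : Prop :=
  exists f : H -> G, bijective f /\ forall x y, adj (f x) (f y) = adj x y.

Definition claw_adj (x y : 'I_4) : bool := (x == ord0) != (y == ord0).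

Lemma claw_adj_sym : ssrbool.symmetric claw_adj.
Proof. by move=> x y; rewrite /claw_adj eq_sym. Qed.

Lemma claw_adj_irr : irreflexive claw_adj.
Proof. by move=> x; rewrite /claw_adj eqxx. Qed.

Definition claw : sgraph := SGraph claw_adj_sym claw_adj_irr.

Definition claw_free (G : sgraph) : Prop := ~ induced_subgraph claw G.

Section Contraction.
Variables (G : sgraph) (S : {set {set G}}).

Definition contract_classes : {set {set G}} :=
  equivalence_partition (connect (fun x y => [set x; y] \in S)) [set: G].

Definition contract_vertex : finType := {C : {set G} | C \in contract_classes}.

Definition contract_adj (C D : contract_vertex) : bool :=
  (C != D) && [exists x in val C, exists y in val D, adj x y].

Lemma contract_adj_sym : ssrbool.symmetric contract_adj.
Proof.
have W C D : contract_adj C D -> contract_adj D C.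
  case/andP=> nCD /exists_inP[x xC /exists_inP[y yD xy]].
  rewrite /contract_adj eq_sym nCD /=; apply/exists_inP; exists y => //.
  by apply/exists_inP; exists x; rewrite // adj_sym.
by move=> C D; apply/idP/idP; apply: W.
Qed.

Lemma contract_adj_irr : irreflexive contract_adj.
Proof. by move=> C; rewrite /contract_adj eqxx. Qed.

(* The vertices are the connected components of the spanning subgraph with edge
   set S; edges of G inside a component disappear and parallel edges between
   two components are merged. *)
Definition contract : sgraph := SGraph contract_adj_sym contract_adj_irr.

End Contraction.

Definition contracts_to (G H : sgraph) : Prop :=
  exists S : {set {set G}}, S \subset edges G /\ isomorphic (contract S) H.

Definition claw_contractible_free (G : sgraph) : Prop :=
  ~ contracts_to G claw.

Section TriangularTower.
Variables a b c : nat.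
Local Open Scope nat_scope.

(* Vertices are numbered from 1 here. *)
Definition tower_edge (i j : nat) : bool :=
  [|| (j == i.+1) && [|| 1 <= i <= a - 1, a + 1 <= i <= a + b - 1
                       | a + b + 1 <= i <= a + b + c - 1]
    | (i, j) \in [:: (1, a + 1); (a + 1, a + b + 1); (a + b + 1, 1);
                     (a, a + b); (a + b, a + b + c); (a + b + c, a)]].

(* The element i of the ordinal type stands for the vertex v_(i+1). The
   condition u != v only matters for degenerate a, b, c < 2. *)
Definition tower_adj (u v : 'I_(a + b + c)) : bool :=
  (u != v) && (tower_edge u.+1 v.+1 || tower_edge v.+1 u.+1).

Lemma tower_adj_sym : ssrbool.symmetric tower_adj.
Proof. by move=> u v; rewrite /tower_adj eq_sym orbC. Qed.

Lemma tower_adj_irr : irreflexive tower_adj.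
Proof. by move=> u; rewrite /tower_adj eqxx. Qed.

Definition triangular_tower : sgraph := SGraph tower_adj_sym tower_adj_irr.

End TriangularTower.

Definition last_var_to_0 (k : nat) : k.+1.-tuple {mpoly rat[k]} :=
  [tuple (if unlift ord_max i is Some j then 'X_j else 0) | i < k.+1].

(* A symmetric function f in x_1, x_2, ... is represented by the compatible
   family of symmetric polynomials f(x_1, ..., x_k, 0, 0, ...), i.e. as an
   element of the inverse limit, in bounded degree, of the rings of symmetric
   polynomials; two symmetric functions are equal when all their members are. *)
Record symfun := SymFun {
  symfun_poly :> forall k : nat, {mpoly rat[k]};
  symfun_sym : forall k, symfun_poly k \is symmetric;
  symfun_restrict : forall k,
    symfun_poly k.+1 \mPo last_var_to_0 k = symfun_poly k;
  symfun_bounded : exists d, forall k, (msize (symfun_poly k) <= d)%N }.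

Section Chromatic.
Variable G : sgraph.

Definition proper_colouring (k : nat) (kappa : {ffun G -> 'I_k}) : bool :=
  [forall u, forall v, adj u v ==> (kappa u != kappa v)].

Definition chromsym_poly (k : nat) : {mpoly rat[k]} :=
  \sum_(kappa : {ffun G -> 'I_k} | proper_colouring kappa)
    \prod_(v : G) 'X_(kappa v).

Lemma chromsym_sym k : chromsym_poly k \is symmetric.
Proof.
apply/issymP => s; rewrite /chromsym_poly raddf_sum /=.
pose h (t : 'S_k) (f : {ffun G -> 'I_k}) := [ffun v => t (f v)].
have hK t : cancel (h t) (h t^-1%g).
  by move=> f; apply/ffunP=> v; rewrite !ffunE permK.
rewrite [RHS](reindex_inj (can_inj (hK s))) /=.
apply: eq_big => [f|f _].
  apply/forallP/forallP => H u; apply/forallP=> v; move: (H u);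
  move=> /forallP/(_ v); by rewrite !ffunE (inj_eq perm_inj).
rewrite rmorph_prod /=; apply: eq_bigr => v _.
rewrite ffunE msymX; congr 'X_[_]; apply/mnmP=> i.
by rewrite !mnmE (can2_eq (permK s) (permKV s)).
Qed.

Lemma chromsym_restrict k :
  chromsym_poly k.+1 \mPo last_var_to_0 k = chromsym_poly k.
Proof.
rewrite /chromsym_poly raddf_sum /=.
have E (f : {ffun G -> 'I_k.+1}) :
    (\prod_(v : G) 'X_(f v)) \mPo last_var_to_0 k =
    \prod_(v : G) (if unlift ord_max (f v) is Some j then 'X_j else 0)
      :> {mpoly rat[k]}.
  rewrite rmorph_prod /=; apply: eq_bigr => v _.
  by rewrite comp_mpolyXU -tnth_nth tnth_mktuple.
rewrite (eq_bigr _ (fun f _ => E f)) {E}.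
pose up (f : {ffun G -> 'I_k}) := [ffun v => lift ord_max (f v)].
have up_inj : injective up.
  move=> f g /ffunP efg; apply/ffunP=> v.
  by move: (efg v); rewrite !ffunE => /lift_inj.
rewrite (bigID (fun f => f \in codom up)) /= addrC big1 ?add0r; last first.
  move=> f /andP[_ /negP nf].
  case: (pickP (fun v => f v == ord_max)) => [v /eqP fv|nmax].
    by rewrite (bigD1 v) //= fv unlift_none mul0r.
  case: nf; have /fin_all_exists[g fg] v : exists j, f v = lift ord_max j.
    have := nmax v; case: (unliftP ord_max (f v)) => [j ->|->].
      by exists j.
    by rewrite eqxx.
  by apply/codomP; exists [ffun v => g v]; apply/ffunP=> v; rewrite !ffunE.
rewrite -big_filter.
transitivity (\sum_(f <- [seq up g | g <- enum {ffun G -> 'I_k}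
     & proper_colouring g]) \prod_(v : G)
       (if unlift ord_max (f v) is Some j then 'X_j else 0 : {mpoly rat[k]})).
  apply: perm_big; apply: uniq_perm.
  - by rewrite filter_uniq // index_enum_uniq.
  - by rewrite map_inj_uniq // filter_uniq // enum_uniq.
  move=> f; rewrite mem_filter mem_index_enum andbT.
  have P g : proper_colouring (up g) = proper_colouring g.
    apply: eq_forallb => u; apply: eq_forallb => v.
    by rewrite !ffunE (inj_eq lift_inj).
  apply/andP/mapP => [[pf /codomP[g ef]]|[g]].
    by exists g; rewrite // mem_filter mem_enum andbT -P -ef.
  by rewrite mem_filter => /andP[pg _] ->; rewrite P codom_f.
rewrite big_map big_filter big_enum_cond /=.
apply: eq_big => [g|g _]; first by rewrite ?andbT.
by apply: eq_bigr => v _; rewrite ffunE liftK.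
Qed.

Lemma chromsym_bounded : exists d, forall k, (msize (chromsym_poly k) <= d)%N.
Proof.
exists #|G|.+1 => k; apply: (leq_trans (msize_sum _ _ _)).
apply/bigmax_leqP => f _; rewrite mprodXE msizeX mdeg_sum.
by rewrite (eq_bigr (fun=> 1%N)) ?sum1_card // => v _; rewrite mdeg1.
Qed.

Definition chromsym : symfun :=
  SymFun chromsym_sym chromsym_restrict chromsym_bounded.

End Chromatic.

Definition is_partition (l : seq nat) : bool := sorted geq l && (0 \notin l)%N.

Definition elementary (l : seq nat) (k : nat) : {mpoly rat[k]} :=
  \prod_(i <- l) mesym k rat i.

Definition e_positive (f : symfun) : Prop :=
  exists (s : seq (seq nat)) (c : seq nat -> rat),
    [/\ uniq s, all is_partition s, (forall l, l \in s -> 0 <= c l) &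
        forall k, f k = \sum_(l <- s) c l *: elementary l k].

(* Main.v *)
(* Evaluate X_G in n variables at the n roots x_0, ..., x_(n-1) of
   X^n = (-1)^(n-1).  By Viete, e_n = 1 there and every other e_k with k > 0
   vanishes, so an e-positive function takes a nonnegative value.  Summing over
   the interior colours of a path on n vertices with end colours p and q gives
   1 - (n-1) [p = q], so X_TT becomes the sum of prod_j (1 - (n-1) [p_j = q_j])
   over pairs of injective triples p, q of colours; this is
   -(n-1) * n (n-1) (n-2) < 0.

   A contraction to the claw labels the vertices by 0 (centre), 1, 2, 3 with
   connected classes, distinct leaf labels being nonadjacent.  Each of the two
   triangles meets at most one leaf class, so some leaf class lies in the
   interior of one of the three paths.  Since the centre class is connected,
   it contains the rest of that path and all of a second path; the other two
   leaf classes then lie in the third path, where they cut off a part of the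
   centre class. *)
Require Import Defs.
From mathcomp Require Import all_boot all_order all_algebra all_field zify ring.
From mathcomp.multinomials Require Import mpoly.

Set Implicit Arguments.
Unset Strict Implicit.
Unset Printing Implicit Defensive.

Import GRing.Theory Num.Theory.

(** * Coordinates and adjacency on the tower *)

(* With n = m.+1, [vtx m j i] is the vertex v_(jn+i+1), the one at position [i]
   of path [j] (j < 3, i < n). *)
Definition vtx m (j i : nat) : triangular_tower m.+1 m.+1 m.+1 :=
  inord (j * m.+1 + i) : 'I_(m + m.+1 + m.+1).+1.

Lemma vtxE m j i : j < 3 -> i <= m -> vtx m j i = j * m.+1 + i :> nat.
Proof.
case: j => [|[|[|//]]] _ le_i;
  by rewrite /vtx (@inordK (m + m.+1 + m.+1)) //; lia.
Qed.

Lemma vtxP m (u : triangular_tower m.+1 m.+1 m.+1) :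
  exists j i, [/\ j < 3, i <= m & u = vtx m j i].
Proof.
have lt_u : (u : nat) < 3 * m.+1.
  by apply: leq_trans (ltn_ord u) _; lia.
exists (u %/ m.+1), (u %% m.+1).
have lt_j : u %/ m.+1 < 3 by rewrite ltn_divLR.
have le_i : u %% m.+1 <= m by rewrite -ltnS ltn_mod.
by split=> //; apply: val_inj; rewrite /= vtxE // -divn_eq.
Qed.

Lemma tower_edge_vtx m j i k l : j < 3 -> i <= m -> k < 3 -> l <= m ->
  tower_edge m.+1 m.+1 m.+1 (j * m.+1 + i).+1 (k * m.+1 + l).+1 =
  [|| (j == k) && (l == i.+1)
    | ((j, k) \in [:: (0, 1); (1, 2); (2, 0)]) &&
      ((i == 0) && (l == 0) || (i == m) && (l == m))].
Proof.
move=> lt_j le_i lt_k le_l; rewrite /tower_edge.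
(* The last vertex of a path and the first of the next have consecutive numbers but are not
   consecutive on a path; the interval conditions exclude exactly this case. *)
have -> : [|| 1 <= (j * m.+1 + i).+1 <= m.+1 - 1,
    m.+1 + 1 <= (j * m.+1 + i).+1 <= m.+1 + m.+1 - 1
  | m.+1 + m.+1 + 1 <= (j * m.+1 + i).+1 <= m.+1 + m.+1 + m.+1 - 1] = (i < m).
  by case: j lt_j => [|[|[|//]]] _; lia.
have -> : ((k * m.+1 + l).+1 == (j * m.+1 + i).+2) && (i < m) =
    (j == k) && (l == i.+1).
  by case: j lt_j => [|[|[|//]]] _; case: k lt_k => [|[|[|//]]] _ /=; lia.
have bottom j0 i0 : j0 < 3 -> i0 <= m ->
    [/\ ((j0 * m.+1 + i0).+1 == 1) = (j0 == 0) && (i0 == 0),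
        ((j0 * m.+1 + i0).+1 == m.+1 + 1) = (j0 == 1) && (i0 == 0)
      & ((j0 * m.+1 + i0).+1 == m.+1 + m.+1 + 1) = (j0 == 2) && (i0 == 0)].
  by case: j0 => [|[|[|//]]] _ le_i0; split; lia.
have top j0 i0 : j0 < 3 -> i0 <= m ->
    [/\ ((j0 * m.+1 + i0).+1 == m.+1) = (j0 == 0) && (i0 == m),
        ((j0 * m.+1 + i0).+1 == m.+1 + m.+1) = (j0 == 1) && (i0 == m)
      & ((j0 * m.+1 + i0).+1 == m.+1 + m.+1 + m.+1) = (j0 == 2) && (i0 == m)].
  by case: j0 => [|[|[|//]]] _ le_i0; split; lia.
rewrite !inE !xpair_eqE.
have [-> -> ->] := bottom _ _ lt_j le_i; have [-> -> ->] := bottom _ _ lt_k le_l.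
have [-> -> ->] := top _ _ lt_j le_i; have [-> -> ->] := top _ _ lt_k le_l.
case: j lt_j {bottom top} => [|[|[|//]]] _; case: k lt_k => [|[|[|//]]] _ /=;
  by rewrite ?andbF ?orbF.
Qed.

Lemma adj_vtx m j i k l : 0 < m -> j < 3 -> i <= m -> k < 3 -> l <= m ->
  adj (vtx m j i) (vtx m k l) =
    if j == k then (l == i.+1) || (i == l.+1)
    else (i == l) && ((i == 0) || (i == m)).
Proof.
move=> m_gt0 lt_j le_i lt_k le_l.
rewrite /adj /= /tower_adj -val_eqE /= !vtxE // !tower_edge_vtx // !inE !xpair_eqE.
case: j lt_j => [|[|[|//]]] _; case: k lt_k => [|[|[|//]]] _ /=; lia.
Qed.

(** * Claw-freeness *)

(** Two neighbours on other paths lie in the triangle of the vertex, so they are equal or adjacent.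
    Hence at least one of them is on the vertex's own path. Keeping only positions turns the
    exclusion of three leaves into arithmetic. *)
Lemma nonadjacent_neighbours m j i k1 l1 k2 l2 : 0 < m ->
  [/\ j < 3, k1 < 3 & k2 < 3] -> [/\ i <= m, l1 <= m & l2 <= m] ->
  vtx m k1 l1 <> vtx m k2 l2 -> adj (vtx m j i) (vtx m k1 l1) ->
  adj (vtx m j i) (vtx m k2 l2) -> ~~ adj (vtx m k1 l1) (vtx m k2 l2) ->
  (l1 = i.+1 /\ i = l2.+1) \/ (l2 = i.+1 /\ i = l1.+1) \/
  ((i = 0 \/ i = m) /\ ((l1 = i /\ l2 <> i) \/ (l2 = i /\ l1 <> i))).
Proof.
move=> m_gt0 [lt_j lt_k1 lt_k2] [le_i le_l1 le_l2] ne12; rewrite !adj_vtx //.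
case: (eqVneq j k1) => [e1|n1]; case: (eqVneq j k2) => [e2|n2].
- subst k1 k2; have ne_l : l1 <> l2 by move=> e; rewrite e in ne12.
  by rewrite eqxx => *; lia.
- by subst k1; rewrite (negPf n2) => *; lia.
- by subst k2; rewrite (eq_sym k1) (negPf n1) => *; lia.
move=> /andP[/eqP e1 iE] /andP[/eqP e2 _]; rewrite -e1 -e2 in ne12 *.
by case: eqP => [e|_]; [rewrite e in ne12 | rewrite eqxx iE].
Qed.

Lemma tower_claw_free m : 0 < m -> claw_free (triangular_tower m.+1 m.+1 m.+1).
Proof.
move=> m_gt0 [f [f_inj f_adj]].
have [j [i [lt_j le_i e0]]] := vtxP (f (inord 0)).
have [j1 [i1 [lt_j1 le_i1 e1]]] := vtxP (f (inord 1)).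
have [j2 [i2 [lt_j2 le_i2 e2]]] := vtxP (f (inord 2)).
have [j3 [i3 [lt_j3 le_i3 e3]]] := vtxP (f (inord 3)).
have neq a b : a < 4 -> b < 4 -> a != b -> f (inord a) <> f (inord b).
  by move=> lt_a lt_b ne_ab /f_inj/(congr1 val); rewrite /= !inordK //; apply/eqP.
have adjE a b : a < 4 -> b < 4 ->
    adj (f (inord a)) (f (inord b)) = ((a == 0) != (b == 0)).
  by move=> lt_a lt_b; rewrite f_adj /= /claw_adj -!val_eqE /= !inordK.
have adj01 := adjE 0 1 isT isT; have adj02 := adjE 0 2 isT isT.
have adj03 := adjE 0 3 isT isT; have adj12 := negbT (adjE 1 2 isT isT).
have adj23 := negbT (adjE 2 3 isT isT); have adj13 := negbT (adjE 1 3 isT isT).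
have n12 := neq 1 2 isT isT isT; have n23 := neq 2 3 isT isT isT.
have n13 := neq 1 3 isT isT isT.
rewrite e0 e1 e2 e3 {neq adjE e0 e1 e2 e3}
  in n12 n23 n13 adj01 adj02 adj03 adj12 adj23 adj13.
have := nonadjacent_neighbours m_gt0 (And3 lt_j lt_j1 lt_j2) (And3 le_i le_i1 le_i2)
  n12 adj01 adj02 adj12.
have := nonadjacent_neighbours m_gt0 (And3 lt_j lt_j1 lt_j3) (And3 le_i le_i1 le_i3)
  n13 adj01 adj03 adj13.
have := nonadjacent_neighbours m_gt0 (And3 lt_j lt_j2 lt_j3) (And3 le_i le_i2 le_i3)
  n23 adj02 adj03 adj23.
(* At an interior centre any two leaves would lie on opposite sides; at a corner exactly one of any
   two would share the centre's position. Three leaves can satisfy neither. *)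
clear -le_i1 le_i2 le_i3 m_gt0; lia.
Qed.

(** * No labelling of the tower describes a contraction to the claw *)

(* [L j i] is the label of vertex [i] of path [j]; the centre of the claw has
   label 0.  Connectedness of a fibre is expressed by: a predicate that is
   constant along its edges is constant. *)
Section Labelling.
Variables (m : nat) (L : nat -> nat -> nat).
Hypothesis m_gt0 : 0 < m.
Hypothesis L_path : forall j i, j < 3 -> i < m -> 0 < L j i -> 0 < L j i.+1 ->
  L j i = L j i.+1.
Hypothesis L_corner : forall j k e, j < 3 -> k < 3 -> e = 0 \/ e = m ->
  0 < L j e -> 0 < L k e -> L j e = L k e.
Hypothesis L_conn : forall c (P : nat -> nat -> bool),
  (forall j i, j < 3 -> i < m -> L j i = c -> L j i.+1 = c ->
     P j i = P j i.+1) ->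
  (forall j k e, j < 3 -> k < 3 -> e = 0 \/ e = m -> L j e = c -> L k e = c ->
     P j e = P k e) ->
  forall j i k l, j < 3 -> i <= m -> k < 3 -> l <= m ->
    L j i = c -> L k l = c -> P j i = P k l.
Hypothesis L_surj : forall c, c < 4 ->
  exists j i, [/\ j < 3, i <= m & L j i = c].

(** The predicate of lying strictly between [i1] and [i2] on path [j] can change along a path edge
    only at one of these two vertices, which are not in the centre. Triangle edges cannot change it,
    since no corner lies strictly between. The connected centre is therefore trapped in the
    segment. *)
Lemma centre_segment j i1 l i2 k i :
  j < 3 -> i1 < l < i2 -> i2 <= m -> 0 < L j i1 -> 0 < L j i2 -> L j l = 0 ->
  k < 3 -> i <= m -> L k i = 0 -> (k == j) && (i1 < i < i2).
Proof.
move=> lt_j lt_l le_i2 pos1 pos2 L0 lt_k le_i Lk0.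
rewrite -(@L_conn 0 (fun k i => (k == j) && (i1 < i < i2)) _ _ j l k i) //.
- by rewrite eqxx.
- move=> k' i' lt_k' lt_i' E1 E2; case: eqP => //= ?; subst k'.
  have ? : i' != i1 by apply: contraTneq pos1 => <-; rewrite E1.
  have ? : i'.+1 != i1 by apply: contraTneq pos1 => <-; rewrite E2.
  have ? : i' != i2 by apply: contraTneq pos2 => <-; rewrite E1.
  have ? : i'.+1 != i2 by apply: contraTneq pos2 => <-; rewrite E2.
  lia.
- by move=> a b e lt_a lt_b eE _ _; lia.
- by lia.
Qed.

(** By [L_path] a nonzero label persists along a path until a centre vertex interrupts it. *)
Lemma between_leaves j i1 i2 : j < 3 -> i1 < i2 -> i2 <= m ->
  0 < L j i1 -> 0 < L j i2 -> L j i1 != L j i2 ->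
  exists2 l, i1 < l < i2 & L j l = 0.
Proof.
move=> lt_j; elim: i2 => // i2 IHi lt_i le_i2 pos1 pos2 ne12.
have [Li0|Li_pos] := posnP (L j i2).
  exists i2 => //; rewrite ltnS leqnn andbT ltn_neqAle -ltnS lt_i andbT.
  by apply: contraTneq pos1 => ->; rewrite Li0.
have eqL := L_path lt_j le_i2 Li_pos pos2.
have lt_i1 : i1 < i2.
  by rewrite ltn_neqAle -ltnS lt_i andbT; apply: contraNneq ne12 => ->; apply/eqP.
have [|l lt_l Ll0] := IHi lt_i1 (ltnW le_i2) pos1 Li_pos; first by rewrite eqL.
by exists l => //; lia.
Qed.

Lemma cornerless_leaf : exists c, [/\ 0 < c < 4 &
  forall j e, j < 3 -> e = 0 \/ e = m -> L j e != c].
Proof.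
have corner e : e = 0 \/ e = m -> exists c,
    forall j, j < 3 -> 0 < L j e -> L j e = c.
  move=> eE.
  have [L0|L0] := posnP (L 0 e); last by exists (L 0 e) => j lt_j Lj; exact: L_corner.
  have [L1|L1] := posnP (L 1 e); last by exists (L 1 e) => j lt_j Lj; exact: L_corner.
  exists (L 2 e) => -[|[|[|//]]] // _; lia.
have [b Lb] := corner 0 (or_introl erefl).
have [t Lt] := corner m (or_intror erefl).
(* Pigeonhole: the two triangles use up at most two of the three leaf labels. *)
have [c /and3P[c4 cb ct]] : exists c, [&& 0 < c < 4, c != b & c != t].
  case: (boolP ((b == 1) || (t == 1))) => H1; last by exists 1; lia.
  by case: (boolP ((b == 2) || (t == 2))) => H2; [exists 3|exists 2]; lia.
exists c; split=> // j e lt_j [->|->]; apply/eqP=> E.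
  by move/eqP: cb; apply; rewrite -E Lb //; lia.
by move/eqP: ct; apply; rewrite -E Lt //; lia.
Qed.

Lemma no_claw_labelling : False.
Proof.
have [c [c4 Lc]] := cornerless_leaf.
have [j [i0 [lt_j le_i0 Lc0]]] := L_surj (proj2 (andP c4)).
(* Class [c] has no corner, so none of its edges changes path. *)
have c_in_j k i : k < 3 -> i <= m -> L k i = c -> k = j.
  move=> lt_k le_i E; apply/eqP.
  rewrite (@L_conn c (fun k _ => k == j) _ _ k i j i0) ?eqxx //.
  by move=> a b e lt_a _ eE La; case/eqP: (Lc a e lt_a eE).
have ex_c : exists i, (i <= m) && (L j i == c) by exists i0; rewrite le_i0 Lc0 /=.
have bnd i : (i <= m) && (L j i == c) -> i <= m by case/andP.
case: (ex_minnP ex_c) => a /andP[le_a /eqP La] min_a.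
case: (ex_maxnP ex_c bnd) => b /andP[le_b /eqP Lb] max_b.
have nz i : i = 0 \/ i = m -> L j i <> c by move=> iE; apply/eqP/Lc.
have a_gt0 : 0 < a by rewrite lt0n; apply: contra_not_neq (nz 0 _) => [<- //|]; left.
have b_ltm : b < m.
  by rewrite ltn_neqAle le_b andbT; apply: contra_not_neq (nz m _) => [<- //|]; right.
have le_ab : a <= b by apply: max_b; rewrite le_a La /=.
(* The positions just outside [a] and [b] border class [c]: a nonzero label there would equal [c] by
   [L_path], against the extremality of [a] and [b]. *)
have La0 : L j a.-1 = 0.
  apply/eqP/negPn/negP => nz0.
  have := @L_path j a.-1 lt_j; rewrite prednK // La.
  rewrite lt0n nz0 => /(_ le_a isT (proj1 (andP c4))) E.
  have := min_a a.-1; rewrite E eqxx; lia.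
have Lb0 : L j b.+1 = 0.
  apply/eqP/negPn/negP => nz0.
  have := @L_path j b lt_j; rewrite Lb (lt0n (L j b.+1)) nz0.
  move=> /(_ b_ltm (proj1 (andP c4)) isT) E.
  have := max_b b.+1; rewrite -E eqxx; lia.
(* A leaf vertex at [i < a] would enclose the centre vertex [a.-1] between itself and [a], while the
   centre vertex [b.+1] lies outside. The claim [high] is the mirror image. *)
have low i : i < a -> L j i = 0.
  move=> lt_i; apply/eqP/negPn/negP; rewrite -lt0n => pos.
  have ne : i != a.-1 by apply: contraTneq pos => ->; rewrite La0.
  have := @centre_segment j i a.-1 a j b.+1 lt_j; rewrite La0 Lb0 La; lia.
have high i : b < i <= m -> L j i = 0.
  move=> lt_i; apply/eqP/negPn/negP; rewrite -lt0n => pos.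
  have ne : i != b.+1 by apply: contraTneq pos => ->; rewrite Lb0.
  have := @centre_segment j b b.+1 i j a.-1 lt_j; rewrite La0 Lb0 Lb; lia.
(* Class [c] stays on path [j], so a foreign vertex between [a] and [b] would disconnect it. *)
have mid i : a <= i <= b -> L j i = c.
  move=> le_i; apply/eqP/negPn/negP => ne.
  have nia : i != a by apply: contraNneq ne => ->; rewrite La.
  suff : (a < i) = (b < i) by lia.
  apply: (@L_conn c (fun _ l => l < i) _ _ j a j b) => // k l lt_k lt_l E1 E2.
  have ? := c_in_j k l.+1 lt_k lt_l E2; subst k.
  have : l.+1 != i by apply: contraNneq ne => <-; rewrite E2.
  by lia.
have [k [lt_k ne_kj Lk0]] : exists k,
    [/\ k < 3, k != j & forall i, i <= m -> L k i = 0].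
  case: (boolP [exists k : 'I_3, (k != j :> nat) && [forall i : 'I_m.+1, L k i == 0]]).
    case/existsP=> k /andP[ne /forallP Lk]; exists k; split=> // i le_i.
    exact/eqP/(Lk (Ordinal (le_i : i < m.+1))).
  move/existsPn => nz_path.
  (* If every path met a leaf class, let [M k] be the first such position on path [k]. The predicate
     [i < M k] is then constant along the edges of the centre: it flips only at [M k], and it holds
     at centre corners at 0 and fails at those at [m]. But it separates [a.-1] from [b.+1]. *)
  pose M k := find (fun i => 0 < L k i) (iota 0 m.+1).
  have MP k : k < 3 -> M k <= m /\ 0 < L k (M k).
    move=> lt_k; have hasM : has (fun i => 0 < L k i) (iota 0 m.+1).
      case: (eqVneq k j) => [->|ne_kj].
        by apply/hasP; exists i0; rewrite ?mem_iota // Lc0; case/andP: c4.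
      have := nz_path (Ordinal lt_k); rewrite ne_kj => /forallPn[i nzi].
      by apply/hasP; exists (i : nat); rewrite ?lt0n // mem_iota ltn_ord.
    have lt_M : M k < m.+1 by rewrite -[ltnRHS](size_iota 0) -has_find.
    by split=> //; have := nth_find 0 hasM; rewrite nth_iota.
  have [le_Mj pos_Mj] := MP j lt_j.
  have : a <= M j <= b.
    apply/negPn/negP; rewrite negb_and -!ltnNge => /orP[/low Lj|lt_bM].
      by rewrite Lj in pos_Mj.
    by rewrite high ?lt_bM in pos_Mj.
  move=> le_Mj_ab; suff : (a.-1 < M j) = (b.+1 < M j) by lia.
  apply: (@L_conn 0 (fun k i => i < M k) _ _ j a.-1 j b.+1) => //; first last.
  - by lia.
  - move=> k l e lt_k lt_l eE E1 E2.
    have [[le_Mk pos_Mk] [le_Ml pos_Ml]] := (MP k lt_k, MP l lt_l).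
    have ? : e != M k by apply: contraTneq pos_Mk => <-; rewrite E1.
    have ? : e != M l by apply: contraTneq pos_Ml => <-; rewrite E2.
    by lia.
  - move=> k i lt_k lt_i E1 E2.
    have [le_M pos_M] := MP k lt_k.
    have ? : i != M k by apply: contraTneq pos_M => <-; rewrite E1.
    have ? : i.+1 != M k by apply: contraTneq pos_M => <-; rewrite E2.
    by lia.
(* Path [j] carries only the labels 0 and [c], and path [k] only 0, so the other leaves sit on the
   remaining path, whose index is [3 - j - k]. *)
have leaf_path d : 0 < d < 4 -> d != c -> exists i,
    i <= m /\ L (3 - j - k) i = d.
  move=> d4 ne_dc; have [l [i [lt_l le_i Ld]]] := L_surj (proj2 (andP d4)).
  exists i; split=> //; have ne_lk : l != k.
    by apply: contraTneq d4 => El; rewrite -Ld El Lk0.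
  suff ne_lj : l != j by have -> : 3 - j - k = l by lia.
  apply: contraTneq ne_dc => El; subst l; rewrite -Ld.
  have [/low Li|le_ai] := ltnP i a; first by rewrite -Ld Li in d4.
  have [le_ib|lt_bi] := leqP i b; first by rewrite mid ?le_ai // eqxx.
  by rewrite -Ld high ?lt_bi in d4.
have [d1 [d2 [d14 d24 [d1c d2c ne_d]]]] : exists d1 d2,
    [/\ 0 < d1 < 4, 0 < d2 < 4 & [/\ d1 != c, d2 != c & d1 != d2]].
  by case: c c4 {Lc Lc0 c_in_j ex_c bnd min_a max_b La Lb nz mid leaf_path}
      => [|[|[|[|//]]]] // _;
    [exists 2, 3|exists 1, 3|exists 1, 2].
have [i1 [le_i1 L1]] := leaf_path _ d14 d1c.
have [i2 [le_i2 L2]] := leaf_path _ d24 d2c.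
have lt_l : 3 - j - k < 3 by lia.
have ne_lj : 3 - j - k != j by lia.
move: (3 - j - k) lt_l ne_lj L1 L2 => l lt_l ne_lj {leaf_path}.
wlog lt_i : d1 d2 d14 d24 d1c d2c ne_d i1 i2 le_i1 le_i2 / i1 < i2.
  move=> IH L1 L2; case: (ltngtP i1 i2) => [lt_i|lt_i|eq_i].
  - exact: (IH d1 d2 _ _ _ _ _ i1 i2).
  - by apply: (IH d2 d1 _ _ _ _ _ i2 i1); rewrite // eq_sym.
  - by case/eqP: ne_d; rewrite -L1 -L2 eq_i.
move=> L1 L2.
(* A centre vertex between the two leaves confines the whole centre to path [l], yet [a.-1] is a
   centre vertex of path [j]. *)
have [i lt_i12 Li] : exists2 i, i1 < i < i2 & L l i = 0.
  by apply: between_leaves; rewrite ?L1 ?L2; lia.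
have := @centre_segment l i1 i i2 j a.-1 lt_l lt_i12 le_i2.
by rewrite L1 L2 => /(_ _ _ Li lt_j _ La0); lia.
Qed.
End Labelling.

(** * From contractions to labellings *)

(** The map [g] sends a vertex to its class and then through the isomorphism onto [H]. The last
    clause is connectedness of the fibres, in the form required by [L_conn]. *)
Lemma contraction_labelling (G H : sgraph) : contracts_to G H ->
  exists g : G -> H,
    [/\ forall c, exists u, g u = c,
        forall u v, adj u v -> g u != g v -> adj (g u) (g v)
      & forall c (P : pred G),
          (forall u v, adj u v -> g u = c -> g v = c -> P u = P v) ->
          forall u v, g u = c -> g v = c -> P u = P v].
Proof.
case=> S [/subsetP sSE [f [f_bij f_adj]]].
pose R := connect (fun x y : G => [set x; y] \in S).
have R_sym : ssrbool.symmetric R.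
  by apply: sym_connect_sym => x y; rewrite setUC.
have R_eq : {in [set: G] & &, equivalence_rel R}.
  move=> x y z _ _ _; split; first exact: connect0.
  by move=> xy; apply: same_connect.
have cP := equivalence_partitionP R_eq.
have clsP u : pblock (contract_classes S) u \in contract_classes S.
  by rewrite pblock_mem // (cover_partition cP) inE.
have tI : trivIset (contract_classes S) by case/and3P: cP.
pose cls u : contract_vertex S := exist (fun C => C \in contract_classes S) _ (clsP u).
have in_cls u : u \in val (cls u).
  by rewrite /= mem_pblock (cover_partition cP) inE.
have clsE u v : (cls u == cls v) = R u v.
  rewrite -val_eqE /= eq_pblock ?(cover_partition cP) ?inE //.
  by rewrite pblock_equivalence_partition ?inE.
have cls_mem u (C : contract_vertex S) : u \in val C -> cls u = C.
  by move=> uC; apply: val_inj; rewrite /= (def_pblock tI (valP C)).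
have cls_surj C : exists u, cls u = C.
  have [u uC] : exists u, u \in val C.
    apply/set0Pn; apply: contraTneq (valP C) => ->.
    by case/and3P: cP.
  by exists u; apply: cls_mem.
have f_inj := bij_inj f_bij; have [f' fK f'K] := f_bij.
exists (f \o cls); split.
- by move=> c; have [u eu] := cls_surj (f' c); exists u; rewrite /= eu f'K.
- move=> u v uv; rewrite /= (inj_eq f_inj) f_adj => ne.
  rewrite /= /contract_adj ne /=.
  by apply/exists_inP; exists u => //; apply/exists_inP; exists v.
move=> c P Pc u v gu gv.
(* Equal labels mean the same class, hence a walk along [S]; the value of [P] is carried along it
   edge by edge, the label staying [c]. *)
have /connectP[p] : R u v.
  rewrite -clsE -(inj_eq f_inj); apply/eqP.
  by rewrite -/((f \o cls) u) gu -gv.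
elim: p u gu => [|w p IHp] u gu /=; first by move=> _ ->.
case/andP=> uw pw ev; have /eqP cls_uw : cls u == cls w by rewrite clsE; apply: connect1.
have -> : P u = P w.
  apply: Pc; rewrite //= -?cls_uw //.
  have := sSE _ uw; rewrite inE => /existsP[x /existsP[y /andP[xy /eqP eq_xy]]].
  have ne_xy : x != y by apply: contraTneq xy => ->; rewrite adj_irr.
  have : u \in [set x; y] by rewrite -eq_xy set21.
  have : w \in [set x; y] by rewrite -eq_xy set22.
  have : x \in [set u; w] by rewrite eq_xy set21.
  have : y \in [set u; w] by rewrite eq_xy set22.
  rewrite !inE => /orP[]/eqP ? /orP[]/eqP ? _ _; subst x y;
    rewrite ?eqxx // in ne_xy *; by rewrite // adj_sym.
by apply: IHp => //; rewrite /= -cls_uw.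
Qed.

Lemma tower_claw_contractible_free m : 0 < m ->
  claw_contractible_free (triangular_tower m.+1 m.+1 m.+1).
Proof.
move=> m_gt0 /contraction_labelling[g [g_surj g_adj g_conn]].
pose L j i : nat := (g (vtx m j i) : 'I_4).
have leafE u v : adj u v -> 0 < (g u : 'I_4) -> 0 < (g v : 'I_4) ->
    (g u : 'I_4) = g v :> nat.
  move=> uv pos_u pos_v; apply/congr1/eqP/negPn/negP => /(g_adj u v uv).
  by rewrite /= /claw_adj -!val_eqE /= !eqn0Ngt pos_u pos_v.
have adj_corner j k e : j < 3 -> k < 3 -> e = 0 \/ e = m ->
    j <> k -> adj (vtx m j e) (vtx m k e).
  move=> lt_j lt_k eE /eqP/negPf ne; have le_e : e <= m by case: eE => ->.
  by rewrite adj_vtx // ne eqxx; case: eE => ->; rewrite eqxx ?orbT.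
have adj_path j i : j < 3 -> i < m -> adj (vtx m j i) (vtx m j i.+1).
  by move=> lt_j lt_i; rewrite adj_vtx ?eqxx // ltnW.
apply: (@no_claw_labelling m L) => //.
- by move=> j i lt_j lt_i; apply/leafE/adj_path.
- move=> j k e lt_j lt_k eE; case: (eqVneq j k) => [-> //|/eqP ne].
  by apply/leafE/adj_corner.
- move=> c P P_path P_corner j i k l lt_j le_i lt_k le_l Lj Lk.
  (* Quotient and remainder by [m.+1] recover the path and the position of a vertex. *)
  pose P' (u : triangular_tower m.+1 m.+1 m.+1) :=
    P ((u : nat) %/ m.+1) ((u : nat) %% m.+1).
  have P'E a b : a < 3 -> b <= m -> P' (vtx m a b) = P a b.
    move=> lt_a le_b; rewrite /P' vtxE // divnMDl // modnMDl.
    by rewrite divn_small // modn_small // addn0.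
  rewrite -!P'E //; apply: (g_conn (g (vtx m j i))) => [u v uv gu gv| |] //; last first.
    by apply: val_inj; rewrite /= -/(L k l) Lk -Lj.
  have [a [b [lt_a le_b eu]]] := vtxP u; have [a' [b' [lt_a' le_b' ev]]] := vtxP v.
  have {gu} Lu : L a b = c by rewrite /L -eu gu.
  have {gv} Lv : L a' b' = c by rewrite /L -ev gv.
  move: uv; rewrite eu ev !P'E // adj_vtx //.
  case: eqVneq => [ea /orP[/eqP eb|/eqP eb]|_ /andP[/eqP eb]].
  - by subst a' b'; apply: P_path.
  - by subst a' b; rewrite -P_path.
  - by subst b'; move=> /orP[]/eqP bE; apply: P_corner => //; [left|right].
- move=> c c4; have [u gu] := g_surj (Ordinal c4).
  have [j [i [lt_j le_i eu]]] := vtxP u.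
  by exists j, i; split=> //; rewrite /L -eu gu.
Qed.

(** * Failure of e-positivity, beginning with weighted colourings of a path *)

Section NotEPositive.
Local Open Scope ring_scope.

Section PathWeight.
Variables (T : finType) (R : comNzRingType) (w : T -> R).

Definition path_proper j (f : {ffun 'I_j.+1 -> T}) :=
  [forall i : 'I_j.+1, forall k : 'I_j.+1, (k == i.+1 :> nat) ==> (f i != f k)].

(** Here [j] counts edges, so the path has [j.+1] vertices; both end vertices contribute their
    weight. *)
Definition path_weight j (p q : T) : R :=
  \sum_(f : {ffun 'I_j.+1 -> T} |
      [&& path_proper f, f ord0 == p & f ord_max == q]) \prod_i w (f i).

Definition ffun_rcons j (f : {ffun 'I_j -> T}) (r : T) : {ffun 'I_j.+1 -> T} :=
  [ffun i => if unlift ord_max i is Some i' then f i' else r].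

Lemma ffun_rcons_lift j (f : {ffun 'I_j -> T}) r i :
  ffun_rcons f r (lift ord_max i) = f i.
Proof. by rewrite ffunE liftK. Qed.

Lemma ffun_rcons_max j (f : {ffun 'I_j -> T}) r : ffun_rcons f r ord_max = r.
Proof. by rewrite ffunE unlift_none. Qed.

Lemma ffun_rcons_bij j :
  bijective (fun fr : {ffun 'I_j -> T} * T => ffun_rcons fr.1 fr.2).
Proof.
exists (fun f : {ffun 'I_j.+1 -> T} =>
    ([ffun i => f (lift ord_max i)], f ord_max)) => [[f r]|f] /=.
  congr (_, _); last exact: ffun_rcons_max.
  by apply/ffunP=> i; rewrite ffunE ffun_rcons_lift.
apply/ffunP=> i; rewrite ffunE; case: unliftP => [i' ->|->] //; by rewrite ffunE.
Qed.

Lemma path_proper_rcons j (f : {ffun 'I_j.+1 -> T}) r :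
  path_proper (ffun_rcons f r) = path_proper f && (f ord_max != r).
Proof.
apply/idP/andP=> [/forallP pf|[/forallP pf ne_r]].
  have pE (i k : 'I_j.+2) : k = i.+1 :> nat -> ffun_rcons f r i != ffun_rcons f r k.
    by move=> ik; have /forallP/(_ k)/implyP := pf i; apply; apply/eqP.
  split.
    apply/forallP=> i; apply/forallP=> k; apply/implyP=> /eqP ik.
    by have := pE (lift ord_max i) (lift ord_max k); rewrite !ffun_rcons_lift !lift_max; apply.
  have := pE (lift ord_max ord_max) ord_max.
  by rewrite ffun_rcons_lift ffun_rcons_max lift_max; apply.
apply/forallP=> i; apply/forallP=> k; apply/implyP.
case: (unliftP ord_max k) => [k' ->|->].
  rewrite lift_max ffun_rcons_lift => /eqP ik.
  case: (unliftP ord_max i) => [i' ei|ei]; last first.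
    by have := ltn_ord k'; rewrite ik ei /= ltnNge leqnSn.
  rewrite ei lift_max in ik *; rewrite ffun_rcons_lift.
  by have /forallP/(_ k')/implyP := pf i'; apply; apply/eqP.
rewrite ffun_rcons_max eqSS => /eqP ik.
have -> : i = lift ord_max ord_max by apply: ord_inj; rewrite lift_max -ik.
by rewrite ffun_rcons_lift.
Qed.

Lemma path_weight0 p q : path_weight 0 p q = if p == q then w p else 0.
Proof.
rewrite /path_weight.
have pp (f : {ffun 'I_1 -> T}) : path_proper f.
  by apply/forallP=> i; apply/forallP=> k; rewrite !ord1.
under eq_bigl => f do rewrite pp (ord1 ord_max) /=.
case: eqP => [<-|ne].
  rewrite (big_pred1 [ffun=> p]) => [|f].
    by rewrite big_ord_recl big_ord0 ffunE mulr1.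
  rewrite andbb; apply/eqP/eqP=> [e|->]; last by rewrite ffunE.
  by apply/ffunP=> i; rewrite ffunE ord1.
by rewrite big_pred0 // => f; apply/negP=> /andP[/eqP-> /eqP].
Qed.

(** Transfer-matrix step: remove the last vertex, coloured [q]. Its predecessor may have any colour
    [r] except [q], which gives the full sum minus one term. *)
Lemma path_weightS j p q : path_weight j.+1 p q =
  (\sum_r path_weight j p r) * w q - path_weight j p q * w q.
Proof.
rewrite (bigD1 q) //= mulrDl [X in X - _]addrC addrK mulr_suml.
rewrite {1}/path_weight (reindex _ (onW_bij _ (ffun_rcons_bij _))) /=.
rewrite -(pair_big_dep xpredT (fun f r => [&& path_proper (ffun_rcons f r),
  ffun_rcons f r ord0 == p & ffun_rcons f r ord_max == q])
  (fun f r => \prod_i w (ffun_rcons f r i))) /=.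
transitivity (\sum_(f : {ffun 'I_j.+1 -> T} |
   [&& path_proper f, f ord0 == p & f ord_max != q])
   (\prod_i w (f i)) * w q).
  rewrite [RHS]big_mkcond /=; apply: eq_bigr => f _.
  have f0 r : ffun_rcons f r ord0 = f ord0.
    have -> : ord0 = lift ord_max ord0 :> 'I_j.+2 by apply: val_inj.
    by rewrite ffun_rcons_lift.
  rewrite big_mkcond (bigD1 q) //= [X in _ + X]big1 => [|r ne_rq]; last first.
    by rewrite ffun_rcons_max (negPf ne_rq) !andbF.
  rewrite addr0 path_proper_rcons f0 ffun_rcons_max eqxx andbT -andbA [_ && (_ == _)]andbC.
  case: ifP => // _; rewrite big_ord_recr /= ffun_rcons_max; congr (_ * _).
  apply: eq_bigr => i _; congr w; rewrite -(ffun_rcons_lift f q); congr (ffun_rcons _ _ _).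
  by apply: ord_inj; rewrite lift_max.
rewrite (partition_big (fun f : {ffun 'I_j.+1 -> T} => f ord_max) (fun r => r != q)) /=.
  apply: eq_bigr => r ne_rq; rewrite mulr_suml; apply: eq_bigl => f.
  by case: (f ord_max =P r) => [->|]; rewrite ?andbF // ne_rq !andbT.
by move=> f /and3P[].
Qed.

End PathWeight.

(** * Path weights at the signed roots of unity *)

Section RootWeights.
Variables (R : fieldType) (m : nat) (x : 'I_m.+1 -> R).
Hypothesis x_inj : injective x.
Hypothesis x_pow : forall i, x i ^+ m.+1 = (-1) ^+ m.
Hypothesis x_psum : forall a, (0 < a < m.+1)%N -> \sum_i x i ^+ a = 0.

(* Expanding the adjacency matrix of the complete graph as J - 1, every term
   with at least two factors J contains a vanishing power sum. *)
Lemma path_weight_expand j p q : (j <= m)%N -> path_weight x j p q =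
  (-1) ^+ j * ((if p == q then x p ^+ j.+1 else 0)
     - \sum_(1 <= a < j.+1) x p ^+ a * x q ^+ (j.+1 - a)).
Proof.
elim: j p q => [|j IHj] p q le_jm.
  by rewrite path_weight0 big_geq // subr0 mul1r.
rewrite path_weightS; have -> : \sum_r path_weight x j p r = (-1) ^+ j * x p ^+ j.+1.
  under eq_bigr => r _ do rewrite IHj 1?ltnW //.
  rewrite -mulr_sumr sumrB -big_mkcond (big_pred1 p) => [|r]; last by rewrite eq_sym.
  rewrite exchange_big /= big_nat big1 ?subr0 // => a a_lt.
  by rewrite -mulr_sumr x_psum ?mulr0 //; lia.
rewrite IHj 1?ltnW // [in RHS]big_nat_recr //= subSnn expr1.
have -> : \sum_(1 <= a < j.+1) x p ^+ a * x q ^+ (j.+2 - a) =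
    (\sum_(1 <= a < j.+1) x p ^+ a * x q ^+ (j.+1 - a)) * x q.
  rewrite mulr_suml; apply: eq_big_nat => a a_lt.
  by rewrite -mulrA -exprSr subSn //; lia.
by case: eqP => [->|_]; rewrite !exprS; ring.
Qed.

(** At [j = m] all monomials have total degree [m.+1]. If [p = q], each is [(-1) ^+ m] and there are
    [m] in the sum. Otherwise, with [z = x p / x q] a nontrivial root of unity, they are
    [(-1) ^+ m * z ^+ a], and the powers of [z] for [a] from 1 to [m] add up to -1. *)
Lemma path_weight_root p q :
  path_weight x m p q = 1 - (if p == q then m%:R else 0).
Proof.
rewrite path_weight_expand //.
have sqr1 : (-1) ^+ m * (-1) ^+ m = 1 :> R by rewrite -expr2 sqrr_sign.
have x_neq0 i : x i != 0.
  apply/eqP=> xi0; have /esym/eqP := x_pow i.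
  by rewrite xi0 expr0n signr_eq0.
case: eqP => [<-|/eqP ne_pq].
  rewrite (eq_big_nat _ _ (F2 := fun=> x p ^+ m.+1)) => [|a a_lt]; last first.
    by rewrite -exprD subnKC //; lia.
  by rewrite x_pow sumr_const_nat subn1 /= mulrBr sqr1 mulrnAr sqr1.
pose z := x p / x q.
have z_neq1 : z != 1.
  by apply: contraNneq ne_pq => /(canRL (divfK (x_neq0 q))); rewrite mul1r => /x_inj->.
have zS : z ^+ m.+1 = 1 by rewrite exprMn exprVn !x_pow divff ?signr_eq0.
have : (z - 1) * \sum_(i < m.+1) z ^+ i = 0 by rewrite -subrX1 zS subrr.
move/eqP; rewrite mulf_eq0 subr_eq0 (negPf z_neq1) /= => /eqP sum0.
rewrite (eq_big_nat _ _ (F2 := fun a => (-1) ^+ m * z ^+ a)) => [|a a_lt]; last first.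
  rewrite exprB ?unitfE ?x_neq0 //; last by lia.
  by rewrite x_pow exprMn exprVn; ring.
rewrite -mulr_sumr sub0r mulrN mulrA sqr1 mul1r subr0.
move: sum0; rewrite -(big_mkord xpredT (fun i => z ^+ i)) big_ltn // expr0.
by move/eqP; rewrite addrC addr_eq0 => /eqP->; rewrite opprK.
Qed.
End RootWeights.

(** * The evaluation point and the elementary symmetric functions there *)

(** The roots are [e * z ^+ i] with [z] a primitive root of unity and [e] one root of [(-1) ^+ m];
    the power sums are geometric sums in [z ^+ a], which differs from 1 for [a] in range. The sign
    makes the product of the roots 1. *)
Lemma exists_signed_roots m : exists x : 'I_m.+1 -> algC,
  [/\ injective x, forall i, x i ^+ m.+1 = (-1) ^+ m,
      forall a, (0 < a < m.+1)%N -> \sum_i x i ^+ a = 0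
    & \prod_i ('X - (x i)%:P) = 'X^(m.+1) - ((-1) ^+ m)%:P].
Proof.
have [z prim_z] := @C_prim_root_exists m.+1 isT.
pose e : algC := m.+1.-root ((-1) ^+ m).
have eE : e ^+ m.+1 = (-1) ^+ m by rewrite rootCK.
have e_neq0 : e != 0 by rewrite rootC_eq0 // signr_eq0.
pose x (i : 'I_m.+1) := e * z ^+ i.
have x_inj : injective x.
  move=> i j /(mulfI e_neq0)/eqP; rewrite (eq_prim_root_expr prim_z).
  by rewrite !modn_small ?ltn_ord // => /eqP/ord_inj.
have x_pow i : x i ^+ m.+1 = (-1) ^+ m.
  by rewrite exprMn eE exprAC (prim_expr_order prim_z) expr1n mulr1.
exists x; split=> //.
  move=> a a_lt; under eq_bigr do rewrite exprMn exprAC.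
  have za : z ^+ a != 1.
    rewrite -(prim_order_dvd prim_z); apply/negP=> /dvdn_leq; lia.
  have : (z ^+ a - 1) * \sum_(i < m.+1) (z ^+ a) ^+ i = 0.
    by rewrite -subrX1 exprAC (prim_expr_order prim_z) expr1n subrr.
  rewrite -mulr_sumr => /eqP; rewrite mulf_eq0 subr_eq0 (negPf za) /= => /eqP->.
  by rewrite mulr0.
set P := RHS.
have P_monic : P \is monic by rewrite monicXnsubC.
have sP : size P = m.+2 by rewrite size_XnsubC.
rewrite -(big_map x xpredT (fun a => 'X - a%:P)).
rewrite [RHS](@all_roots_prod_XsubC _ _ (map x (index_enum 'I_m.+1))).
- by rewrite (monicP P_monic) scale1r big_map.
- by rewrite size_map [index_enum _]unlock -enumT size_enum_ord sP.
- apply/allP=> _ /mapP[i _ ->]; rewrite /root !hornerE x_pow subrr //.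
by rewrite uniq_rootsE map_inj_uniq // index_enum_uniq.
Qed.

(** By Viete the value is [(-1) ^+ k] times the coefficient of degree [m.+1 - k], and only the two
    extreme coefficients survive. For [k > m.+1] there are no [k]-subsets of the variables. *)
Lemma mmap_mesym m (x : 'I_m.+1 -> algC) :
  \prod_i ('X - (x i)%:P) = 'X^(m.+1) - ((-1) ^+ m)%:P ->
  forall k, mmap ratr x (mesym m.+1 rat k) = ((k == 0%N) || (k == m.+1))%:R.
Proof.
move=> xE k.
have [lt_k|le_k] := ltnP m.+1 k.
  rewrite /mesym big_pred0 => [|h]; first by rewrite raddf0 !gtn_eqF // (leq_ltn_trans _ lt_k).
  by apply/ltn_eqF/(leq_ltn_trans _ lt_k); rewrite -[leqRHS]card_ord max_card.
pose cs := [tuple x i | i < m.+1].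
have := mroots_coeff cs (Ordinal (le_k : k < m.+2)%N).
rewrite big_tuple; under eq_bigr do rewrite tnth_mktuple.
rewrite xE => /=.
have -> : (mesym m.+1 algC k).@[tnth cs] = mmap ratr x (mesym m.+1 rat k).
  rewrite /mesym !raddf_sum; apply: eq_bigr => h _ /=.
  rewrite !rmorph_prod /=; apply: eq_bigr => i _.
  by rewrite mevalXU tnth_mktuple mmapX mmap1U.
rewrite coefB coefXn coefC.
move/(congr1 (fun c => (-1) ^+ k * c)); rewrite mulrA -expr2 sqrr_sign mul1r => <-.
case: k le_k => [|k] le_k; first by rewrite subn0 eqxx expr0 subr0 mul1r.
have -> : (m.+1 - k.+1 == m.+1)%N = false by lia.
rewrite /= eqSS; have [->|ne_km] := eqVneq k m.
  by rewrite subnn eqxx sub0r mulrN exprS mulN1r mulNr opprK -expr2 sqrr_sign.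
by rewrite subSS subn_eq0 leqNgt ltn_neqAle ne_km -ltnS le_k subrr mulr0.
Qed.

(** * Tower colourings as triples of path colourings *)

Section TowerColouring.
Variable m : nat.
Local Notation tower := (triangular_tower m.+1 m.+1 m.+1).

Definition tower_glue (T : finType) (F : {ffun 'I_3 -> {ffun 'I_m.+1 -> T}}) :
  {ffun tower -> T} :=
  [ffun u : tower => F (inord ((u : nat) %/ m.+1)) (inord ((u : nat) %% m.+1))].

Lemma vtx_ordE (j : 'I_3) (i : 'I_m.+1) :
  vtx m j i = (j * m.+1 + i)%N :> nat.
Proof. by apply: vtxE; [exact: ltn_ord | rewrite -ltnS; exact: ltn_ord]. Qed.

Lemma vtx_div (j : 'I_3) (i : 'I_m.+1) :
  inord ((vtx m j i : nat) %/ m.+1) = j.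
Proof.
apply: ord_inj; rewrite vtx_ordE divnMDl // (divn_small (ltn_ord i)) addn0.
by rewrite inord_val.
Qed.

Lemma vtx_mod (j : 'I_3) (i : 'I_m.+1) :
  inord ((vtx m j i : nat) %% m.+1) = i.
Proof.
by apply: ord_inj; rewrite vtx_ordE modnMDl (modn_small (ltn_ord i)) inord_val.
Qed.

Lemma tower_glue_vtx (T : finType) (F : {ffun 'I_3 -> {ffun 'I_m.+1 -> T}})
  (j : 'I_3) (i : 'I_m.+1) : tower_glue F (vtx m j i) = F j i.
Proof.
by rewrite ffunE vtx_div vtx_mod.
Qed.

Lemma vtx_ordP (u : tower) : exists (j : 'I_3) (i : 'I_m.+1), u = vtx m j i.
Proof.
have [j [i [lt_j le_i ->]]] := vtxP u.
by exists (Ordinal lt_j), (Ordinal (le_i : i < m.+1)%N).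
Qed.

Lemma tower_glue_bij (T : finType) : bijective (@tower_glue T).
Proof.
exists (fun f : {ffun tower -> T} =>
    [ffun j : 'I_3 => [ffun i : 'I_m.+1 => f (vtx m j i)]]) => F.
  by apply/ffunP=> j; apply/ffunP=> i; rewrite ffunE ffunE tower_glue_vtx.
apply/ffunP=> u; have [j [i ->]] := vtx_ordP u.
by rewrite tower_glue_vtx !ffunE.
Qed.

Lemma tower_glue_prod (T : finType) (R : comNzRingType) (w : T -> R)
    (F : {ffun 'I_3 -> {ffun 'I_m.+1 -> T}}) :
  \prod_(u : tower) w (tower_glue F u) = \prod_j \prod_i w (F j i).
Proof.
rewrite pair_bigA (reindex (fun ji : 'I_3 * 'I_m.+1 => vtx m ji.1 ji.2)) /=.
  by apply: eq_bigr => -[j i] _; rewrite tower_glue_vtx.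
apply: onW_bij; exists (fun u : tower =>
    (inord ((u : nat) %/ m.+1), inord ((u : nat) %% m.+1))).
  by move=> [j i]; rewrite /= vtx_div vtx_mod.
move=> u; have [j [i ->]] := vtx_ordP u.
by rewrite /= vtx_div vtx_mod.
Qed.

Lemma tower_glue_proper k (F : {ffun 'I_3 -> {ffun 'I_m.+1 -> 'I_k}}) :
  (0 < m)%N -> proper_colouring (tower_glue F) =
  [&& [forall j, path_proper (F j)], injectiveb [ffun j => F j ord0]
    & injectiveb [ffun j => F j ord_max]].
Proof.
move=> m_gt0.
have adjE (j l : 'I_3) (i t : 'I_m.+1) : adj (vtx m j i) (vtx m l t) =
    if j == l then (t == i.+1 :> nat) || (i == t.+1 :> nat)
    else (i == t) && ((i == ord0) || (i == ord_max)).
  by rewrite adj_vtx // -ltnS.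
apply/idP/and3P=> [/forallP pF|[/forallP pF /injectiveP inj0 /injectiveP injm]].
  have pE (j l : 'I_3) (i t : 'I_m.+1) :
      adj (vtx m j i) (vtx m l t) -> F j i != F l t.
    move=> jl; have /forallP/(_ (vtx m l t)) := pF (vtx m j i).
    by rewrite jl !tower_glue_vtx.
  split.
  - apply/forallP=> j; apply/forallP=> i; apply/forallP=> t; apply/implyP=> it.
    by apply: pE; rewrite adjE eqxx it.
  - apply/injectiveP=> j l; rewrite !ffunE => /eqP; apply: contraTeq => /negPf ne.
    by apply: pE; rewrite adjE ne !eqxx.
  apply/injectiveP=> j l; rewrite !ffunE => /eqP; apply: contraTeq => /negPf ne.
  by apply: pE; rewrite adjE ne !eqxx orbT.
have pP (j : 'I_3) (i t : 'I_m.+1) : t = i.+1 :> nat -> F j i != F j t.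
  by move=> /eqP it; have /forallP/(_ i)/forallP/(_ t)/implyP := pF j; apply.
apply/forallP=> u; apply/forallP=> v; apply/implyP.
have [j [i ->]] := vtx_ordP u; have [l [t ->]] := vtx_ordP v.
rewrite adjE !tower_glue_vtx; case: eqVneq => [<-|ne_jl].
  by case/orP=> /eqP /pP; rewrite // eq_sym.
case/andP=> /eqP <- /orP[]/eqP ->; apply: contraNneq ne_jl => eF; apply/eqP.
  by apply: inj0; rewrite !ffunE.
by apply: injm; rewrite !ffunE.
Qed.

(** Once the colours [p] and [q] of the two triangles are fixed, the three paths are coloured
    independently, so the sum factorises. *)
Lemma sum_tower_colourings k (R : comNzRingType) (w : 'I_k -> R) : (0 < m)%N ->
  \sum_(f : {ffun tower -> 'I_k} | proper_colouring f) \prod_u w (f u) =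
  \sum_(p : {ffun 'I_3 -> 'I_k} | injectiveb p)
    \sum_(q : {ffun 'I_3 -> 'I_k} | injectiveb q)
      \prod_j path_weight w m (p j) (q j).
Proof.
move=> m_gt0; rewrite (reindex _ (onW_bij _ (tower_glue_bij _))) /=.
under eq_bigl do rewrite tower_glue_proper //.
under eq_bigr do rewrite tower_glue_prod.
rewrite (partition_big (fun F : {ffun 'I_3 -> {ffun 'I_m.+1 -> 'I_k}} =>
  [ffun j => F j ord0]) (fun p => injectiveb p)) /= => [|F /and3P[] //].
apply: eq_bigr => p p_inj.
rewrite (partition_big (fun F : {ffun 'I_3 -> {ffun 'I_m.+1 -> 'I_k}} =>
  [ffun j => F j ord_max]) (fun p => injectiveb p)) /= => [|F /andP[/and3P[] //]].
apply: eq_bigr => q q_inj.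
rewrite (bigA_distr_big_dep (fun j (f : {ffun 'I_m.+1 -> 'I_k}) =>
  [&& path_proper f, f ord0 == p j & f ord_max == q j])) /=.
apply: eq_bigl => F; apply/andP/familyP=> [[/andP[/and3P[/forallP pF _ _]]]|HF].
  move=> /eqP/ffunP ep /eqP/ffunP eq j; rewrite unfold_in /= pF -(ep j) -(eq j).
  by rewrite !ffunE !eqxx.
have ep : [ffun j => F j ord0] = p.
  by apply/ffunP=> j; have /and3P[_ /eqP e _] := HF j; rewrite ffunE.
have eq : [ffun j => F j ord_max] = q.
  by apply/ffunP=> j; have /and3P[_ _ /eqP e] := HF j; rewrite ffunE.
rewrite ep eq p_inj q_inj !eqxx /= !andbT; split=> //.
by apply/forallP=> j; have /and3P[] := HF j.
Qed.
End TowerColouring.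

(** * Sums over triples of distinct colours *)

Lemma sum_ffun3 (T : finType) (R : comNzRingType) (G : {ffun 'I_3 -> T} -> R) :
  \sum_q G q =
  \sum_a \sum_b \sum_c G [ffun j : 'I_3 => nth a [:: a; b; c] j].
Proof.
rewrite pair_bigA pair_bigA /=.
apply: (reindex (fun t : T * T * T =>
  [ffun j : 'I_3 => nth t.1.1 [:: t.1.1; t.1.2; t.2] j])).
exists (fun q : {ffun 'I_3 -> T} => (q ord0, q (inord 1), q ord_max)).
  by move=> [[a b] c] _; rewrite !ffunE /= inordK.
move=> q _; apply/ffunP=> -[[|[|[|//]]] lt_j]; rewrite ffunE /=;
  by congr (q _); apply: val_inj; rewrite /= ?inordK.
Qed.

Lemma injective_ffun3 (T : finType) (a b c : T) :
  injectiveb [ffun j : 'I_3 => nth a [:: a; b; c] j] =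
  [&& a != b, a != c & b != c].
Proof.
have -> : [&& a != b, a != c & b != c] = uniq [:: a; b; c].
  by rewrite /= !inE negb_or andbT -andbA.
apply/injectiveP/(uniqP a) => [inj i j lt_i lt_j eq_ij|inj i j].
  have := inj (Ordinal lt_i) (Ordinal lt_j); rewrite !ffunE => /(_ eq_ij).
  by move/(congr1 val).
by rewrite !ffunE => /inj eq_ij; apply: ord_inj; apply: eq_ij; rewrite inE ltn_ord.
Qed.

(** Moebius inversion over the partitions of a three-element set: each merged pair has coefficient
    -1, the single block has 2. *)
Lemma sum_distinct3 (T : finType) (R : comNzRingType) (A B C : T -> R) :
  \sum_a \sum_b \sum_c (if [&& a != b, a != c & b != c] then A a * B b * C c else 0) =
  (\sum_a A a) * (\sum_a B a) * (\sum_a C a) - (\sum_a A a * B a) * (\sum_a C a)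
  - (\sum_a A a * C a) * (\sum_a B a) - (\sum_a B a * C a) * (\sum_a A a)
  + (\sum_a A a * B a * C a) *+ 2.
Proof.
have off (F : T -> R) a : \sum_(b | a != b) F b = \sum_b F b - F a.
  rewrite [in RHS](bigD1 a) //= [RHS]addrAC subrr add0r; apply: eq_bigl => b.
  by rewrite eq_sym.
have inner a b : a != b ->
    \sum_(c | (a != c) && (b != c)) C c = \sum_c C c - C a - C b.
  move=> ne; rewrite [in RHS](bigD1 a) //= [X in _ + X - _ - _](bigD1 b) /=; last by rewrite eq_sym.
  rewrite [C a + _]addrC addrK [RHS]addrAC subrr add0r; apply: eq_bigl => c.
  by rewrite eq_sym [c == b]eq_sym.
transitivity (\sum_a \sum_(b | a != b) A a * B b * (\sum_c C c - C a - C b)).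
  apply: eq_bigr => a _; rewrite [RHS]big_mkcond; apply: eq_bigr => b _.
  case: ifP => [ne|_]; last by rewrite big1.
  by rewrite -inner // mulr_sumr [RHS]big_mkcond.
transitivity (\sum_a A a * ((\sum_c C c - C a) * (\sum_b B b - B a) -
   (\sum_b B b * C b - B a * C a))).
  apply: eq_bigr => a _; rewrite -(off B) -(off (fun b => B b * C b)) mulr_sumr -sumrB mulr_sumr.
  by apply: eq_bigr => b _; ring.
set SA := \sum_a A a; set SB := \sum_a B a; set SC := \sum_a C a.
set SBC := \sum_a B a * C a.
rewrite (eq_bigr (fun a => A a * (SC * SB - SBC) - SC * (A a * B a) - SB * (A a * C a)
   + (A a * B a * C a) *+ 2)) => [|a _]; last by ring.
rewrite !big_split /= !sumrN -mulr_suml -!mulr_sumr -/SA; ring.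
Qed.

(** Each factor is [W j = 1 - m d j] with [d j] the indicator of [p j]. Since [p] is injective,
    products of different [d j] vanish, so the sums of one, two and three factors are 1, [1 - m] and
    [1 - 2m]. By [sum_distinct3] the result is [1 - 3(1 - m) + 2(1 - 2m) = -m], whatever [p] is. *)
Lemma tower_weight_sum (T : finType) (R : comNzRingType) (m : nat)
    (p : {ffun 'I_3 -> T}) : #|T| = m.+1 -> injectiveb p ->
  \sum_(q : {ffun 'I_3 -> T} | injectiveb q)
    \prod_j (1 - (if p j == q j then m%:R else 0)) = - m%:R :> R.
Proof.
move=> cardT /injectiveP p_inj.
pose d (j : 'I_3) a : R := if p j == a then 1 else 0.
pose W j a := 1 - m%:R * d j a.
have sumd j : \sum_a d j a = 1.
  by rewrite -big_mkcond (big_pred1 (p j)) // => a; rewrite eq_sym.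
have sum1 : \sum_(a : T) 1 = m.+1%:R :> R by rewrite sumr_const cardT.
have dd j l a : j != l -> d j a * d l a = 0.
  move=> ne; rewrite /d; case: eqP => [<-|_]; last by rewrite mul0r.
  by rewrite (inj_eq p_inj) eq_sym (negPf ne) mulr0.
have sumW j : \sum_a W j a = 1.
  by rewrite sumrB -mulr_sumr sumd sum1 -natr1; ring.
have sumWW j l : j != l -> \sum_a W j a * W l a = 1 - m%:R.
  move=> ne; rewrite (eq_bigr (fun a => 1 - m%:R * (d j a + d l a))) => [|a _].
    by rewrite sumrB -mulr_sumr big_split /= !sumd sum1 -natr1; ring.
  transitivity (1 - m%:R * (d j a + d l a) + m%:R ^+ 2 * (d j a * d l a)).
    by rewrite /W; ring.
  by rewrite dd // mulr0 addr0.
pose j0 : 'I_3 := ord0; pose j1 : 'I_3 := inord 1; pose j2 : 'I_3 := ord_max.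
have n01 : j0 != j1 by rewrite -val_eqE /= inordK.
have n12 : j1 != j2 by rewrite -val_eqE /= inordK.
have n02 : j0 != j2 by [].
have sumWWW : \sum_a W j0 a * W j1 a * W j2 a = 1 - m%:R *+ 2.
  rewrite (eq_bigr (fun a => 1 - m%:R * (d j0 a + d j1 a + d j2 a))) => [|a _].
    by rewrite sumrB -mulr_sumr !big_split /= !sumd sum1 -natr1; ring.
  transitivity (1 - m%:R * (d j0 a + d j1 a + d j2 a)
      + m%:R ^+ 2 * (d j0 a * d j1 a + d j0 a * d j2 a + d j1 a * d j2 a)
      - m%:R ^+ 3 * (d j0 a * d j1 a) * d j2 a); first by rewrite /W; ring.
  by rewrite !dd // !addr0 !mulr0 mul0r subr0 addr0.
have WE (q : {ffun 'I_3 -> T}) :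
    \prod_j (1 - (if p j == q j then m%:R else 0)) =
    W j0 (q j0) * W j1 (q j1) * W j2 (q j2).
  rewrite (eq_bigr (fun j => W j (q j))) => [|j _]; last first.
    by rewrite /W /d; case: ifP; rewrite ?mulr1 ?mulr0.
  rewrite !big_ord_recl big_ord0 mulr1 mulrA.
  have -> : lift ord0 ord0 = j1 by apply: val_inj; rewrite /= inordK.
  by have -> : lift ord0 (lift ord0 ord0) = j2 by apply: val_inj.
under eq_bigr do rewrite WE.
rewrite big_mkcond sum_ffun3.
transitivity (\sum_a \sum_b \sum_c (if [&& a != b, a != c & b != c]
    then W j0 a * W j1 b * W j2 c else 0)).
  do 3![apply: eq_bigr => ? _]; rewrite injective_ffun3; case: ifP => // _.
  by rewrite !ffunE /j1 inordK.
by rewrite sum_distinct3 !sumW !sumWW // sumWWW; ring.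
Qed.

(** * The negative value *)

Lemma tower_not_e_positive m : (1 < m)%N ->
  ~ e_positive (chromsym (triangular_tower m.+1 m.+1 m.+1)).
Proof.
move=> m_gt1 [s [c [_ _ c_ge0 Xs]]].
have [x [x_inj x_pow x_psum x_prod]] := exists_signed_roots m.
have m_gt0 : (0 < m)%N by apply: ltnW.
have := congr1 (mmap ratr x) (Xs m.+1); rewrite /= /chromsym_poly.
rewrite raddf_sum /= (eq_bigr (fun f : {ffun triangular_tower m.+1 m.+1 m.+1 -> 'I_m.+1} =>
    \prod_u x (f u))) => [|f _]; last first.
  by rewrite rmorph_prod /=; apply: eq_bigr => u _; rewrite mmapX mmap1U.
rewrite sum_tower_colourings //.
rewrite (eq_bigr (fun=> - m%:R)) => [|p p_inj]; last first.
  rewrite -(tower_weight_sum _ _ p_inj) ?card_ord //.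
  apply: eq_bigr => q _; apply: eq_bigr => j _; exact: path_weight_root.
rewrite sumr_const.
have -> : #|[pred p : {ffun 'I_3 -> 'I_m.+1} | injectiveb p]| = (m.+1 ^_ 3)%N.
  by rewrite -[LHS]cardsE card_inj_ffuns !card_ord.
(* The e-expansion has a nonnegative value, since each elementary factor becomes 0 or 1; the
   colouring sum is [-m] for each of the [m.+1 ^_ 3] injective triples, a positive number of them
   because [1 < m]. *)
move=> eqX; have : 0 <= - (m%:R : algC) *+ m.+1 ^_ 3.
  rewrite eqX raddf_sum big_seq sumr_ge0 // => l ls /=.
  rewrite mmapZ mulr_ge0 ?ler0q ?c_ge0 // rmorph_prod prodr_ge0 // => i _.
  by rewrite /= mmap_mesym // ler0n.
rewrite mulNrn oppr_ge0 -mulrnA lern0 muln_eq0 !eqn0Ngt m_gt0 ffact_gt0.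
by rewrite ltnS m_gt1.
Qed.

End NotEPositive.

Theorem theorem4p5 (n : nat) (hn : 3 <= n) :
  claw_contractible_free (triangular_tower n n n) /\
  claw_free (triangular_tower n n n) /\
  ~ e_positive (chromsym (triangular_tower n n n)).
Proof.
case: n hn => // m m_gt1; have m_gt0 : 0 < m by apply: ltnW.
split; first exact: tower_claw_contractible_free.
by split; [exact: tower_claw_free | exact: tower_not_e_positive].
Qed.
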